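(* Let $X$ be a complex Banach space, $A\in BL(X)$, $z\in\mathbb{C}\setminus\sigma(A)$, and let $x,y\in X$ with $y\neq 0$ satisfy $Ax-zx=y$. Let $\delta y\in X$ be a perturbation of $y$ and let $\delta x\in X$ be the corresponding perturbation of the solution, i.e. $(A-zI)(x+\delta x)=y+\delta y$. Then $$\kappa(z,A)\,\frac{\|\delta y\|}{\|y\|}\le \frac{\|\delta x\|}{\|x\|}\le \frac{1}{\kappa(z,A)}\,\frac{\|\delta y\|}{\|y\|},$$ where $\kappa(z,A):=\sup\{0<\epsilon<1: z\notin\sigma_\epsilon(A)\}$.
   Context: $BL(X)$ is the Banach algebra of all bounded linear operators on the complex Banach space $X$, with identity $I$. The spectrum is $\sigma(A)=\{z\in\mathbb{C}: A-zI \text{ is not invertible}\}$. For $0<\epsilon<1$ the $\epsilon$-condition pseudospectrum of $A$ is $$\sigma_\epsilon(A)=\sigma(A)\cup\{z\in\mathbb{C}: \|A-zI\|\,\|(A-zI)^{-1}\|\ge \epsilon^{-1}\}.$$ *)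

(* Defs.v *)
From Stdlib Require Import Reals.
From Coquelicot Require Import Coquelicot.

Open Scope R_scope.

(* [T] belongs to BL(X) when [is_linear T], Coquelicot's predicate for
   *bounded* linear maps. Operators are plain functions [X -> X] below; the
   definitions are only meaningful for bounded linear ones. *)

Section Operators.

Context {X : CompleteNormedModule C_AbsRing}.

(* sup of ||T u|| over the unit ball. For a bounded linear [T] this supremum
   is finite and the set is nonempty, so taking its real part loses nothing. *)
Definition op_norm (T : X -> X) : R :=
  real (Lub_Rbar (fun r => exists u : X, norm u <= 1 /\ r = norm (T u))).

Definition shift (A : X -> X) (z : C) : X -> X :=
  fun u => minus (A u) (scal z u).

(* Inversion in the algebra BL(X): the inverse has to be bounded linear too. *)
Definition is_inverse (T S : X -> X) : Prop :=
  is_linear S /\ (forall u : X, S (T u) = u) /\ (forall u : X, T (S u) = u).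

Definition invertible (T : X -> X) : Prop := exists S : X -> X, is_inverse T S.

Definition spectrum (A : X -> X) (z : C) : Prop := ~ invertible (shift A z).

(* The inverse of [shift A z] is unique when it exists, so quantifying it
   existentially just names it. *)
Definition cond_pseudospectrum (eps : R) (A : X -> X) (z : C) : Prop :=
  spectrum A z \/
  exists S : X -> X,
    is_inverse (shift A z) S /\ op_norm (shift A z) * op_norm S >= / eps.

(* The set is bounded by 1; it is nonempty whenever z is outside the spectrum,
   in which case [kappa] is its supremum in R. *)
Definition kappa (z : C) (A : X -> X) : R :=
  real (Lub_Rbar (fun eps => 0 < eps < 1 /\ ~ cond_pseudospectrum eps A z)).

End Operators.

(* Main.v *)
(** Writing [T = A - zI], the pseudospectral condition [z] outside [sigma_eps A]
    reads [eps < / (||T|| ||T^-1||)], and [||T|| ||T^-1|| >= 1], so [kappa z A] is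
    the reciprocal of the condition number. The perturbation satisfies
    [T dx = dy], and the estimates are the classical ones for linear systems. *)

Require Import Defs.
From Stdlib Require Import Reals Lra Classical.
From Coquelicot Require Import Coquelicot.
Open Scope R_scope.

Section Operators.

Context {X : CompleteNormedModule C_AbsRing}.

Implicit Types (T S A : X -> X) (u v : X) (z : C).

Lemma norm_pos_of_neq_zero u : u <> zero -> 0 < norm u.
Proof.
  intros Hu. destruct (norm_ge_0 u) as [H|H]; [exact H|].
  exfalso. apply Hu. apply (@norm_eq_zero C_AbsRing X). symmetry. exact H.
Qed.

Lemma norm_scal_RtoC (r : R) u :
  0 <= r -> norm (scal (RtoC r : C_AbsRing) u) <= r * norm u.
Proof.
  intros Hr.
  pose proof (norm_scal (RtoC r : C_AbsRing) u) as H.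
  change (abs (RtoC r : C_AbsRing)) with (Cmod (RtoC r)) in H.
  rewrite Cmod_R, Rabs_pos_eq in H; assumption.
Qed.

Lemma op_norm_ub T u : is_linear T -> norm u <= 1 -> norm (T u) <= op_norm T.
Proof.
  intros [_ _ [M [HM HT]]] Hu.
  unfold op_norm.
  set (E := fun r => exists u : X, norm u <= 1 /\ r = norm (T u)).
  destruct (Lub_Rbar_correct E) as [Hub Hlub].
  assert (HE : Rbar_le (norm (T u)) (Lub_Rbar E)).
  { apply Hub. exists u. split; [exact Hu|reflexivity]. }
  assert (HB : Rbar_le (Lub_Rbar E) M).
  { apply Hlub. intros r [v [Hv ->]]. simpl.
    apply Rle_trans with (1 := HT v).
    rewrite <- (Rmult_1_r M) at 2.
    apply Rmult_le_compat_l; lra. }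
  (* [real] sends both infinities to 0, so finiteness is essential: [HE] excludes [m_infty], and the
     bound [M] carried by [is_linear] excludes [p_infty]. *)
  destruct (Lub_Rbar E) as [l| |]; simpl in *; tauto.
Qed.

Lemma norm_le_op_norm T u : is_linear T -> norm (T u) <= op_norm T * norm u.
Proof.
  intros HT.
  destruct (classic (u = zero)) as [->|Hu].
  { assert (HT0 : T zero = zero) by exact (linear_zero T HT).
    assert (H0 : norm (zero : X) = 0) by exact (@norm_zero C_AbsRing X).
    rewrite HT0, H0. lra. }
  pose proof (norm_pos_of_neq_zero u Hu) as Hn.
  (* Normalise [u] into the unit ball, the only place where [op_norm] gives information. *)
  pose (w := scal (RtoC (/ norm u) : C_AbsRing) u).
  assert (Hi : 0 < / norm u) by (apply Rinv_0_lt_compat; exact Hn).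
  assert (Hw : norm w <= 1).
  { apply Rle_trans with (1 := norm_scal_RtoC (/ norm u) u (Rlt_le _ _ Hi)).
    rewrite Rinv_l; lra. }
  assert (Hu' : u = scal (RtoC (norm u) : C_AbsRing) w).
  { unfold w. rewrite scal_assoc.
    change (mult (RtoC (norm u) : C_AbsRing) (RtoC (/ norm u)))
      with (Cmult (RtoC (norm u)) (RtoC (/ norm u))).
    rewrite <- RtoC_mult, Rinv_r by lra.
    symmetry. apply (scal_one u). }
  rewrite Hu' at 1. rewrite (linear_scal T HT).
  apply Rle_trans with (1 := norm_scal_RtoC (norm u) (T w) (Rlt_le _ _ Hn)).
  rewrite Rmult_comm.
  apply Rmult_le_compat_r; [lra|]. apply op_norm_ub; assumption.
Qed.

Lemma is_linear_shift A z : is_linear A -> is_linear (shift A z).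
Proof.
  intros HA. unfold shift, minus.
  apply (is_linear_comp (fun u => (A u, opp (scal z u)))
                        (fun p => plus (fst p) (snd p))).
  - apply is_linear_prod; [exact HA|].
    apply (is_linear_comp (fun u => scal z u) opp).
    + apply (@is_linear_scal_r C_AbsRing X z).
      intros b. apply Cmult_comm.
    + apply (@is_linear_opp C_AbsRing X).
  - apply (@is_linear_plus C_AbsRing X).
Qed.

Lemma is_inverse_unique T S S' :
  is_inverse T S -> is_inverse T S' -> forall u, S u = S' u.
Proof.
  intros [_ [HS _]] [_ [_ HS']] u.
  rewrite <- (HS' u) at 1. apply HS.
Qed.

(** Inverses are unique only pointwise; this carries that uniqueness over to their norms without
    functional extensionality. *)
Lemma op_norm_ext T S : (forall u, T u = S u) -> op_norm T = op_norm S.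
Proof.
  intros H. unfold op_norm. f_equal. apply Lub_Rbar_eqset.
  intros r. split; intros [u [Hu ->]]; exists u; rewrite H; auto.
Qed.

Lemma op_norm_pos T u : is_linear T -> T u <> zero -> 0 < op_norm T.
Proof.
  intros HT Hu.
  pose proof (norm_le_op_norm T u HT) as H.
  pose proof (norm_pos_of_neq_zero _ Hu).
  pose proof (norm_ge_0 u).
  destruct (Rlt_or_le 0 (op_norm T)) as [Hp|Hn]; [exact Hp|].
  nra.
Qed.

(** Apply both norm bounds to [u = T (S u)] and divide by [norm u]. The nonzero [u] rules out the
    trivial space, where both operator norms are 0. *)
Lemma condition_number_ge_1 T S u :
  is_linear T -> is_inverse T S -> u <> zero -> 1 <= op_norm T * op_norm S.
Proof.
  intros HT [HS [_ HTS]] Hu.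
  pose proof (norm_pos_of_neq_zero u Hu) as Hn.
  assert (HTSu : T (S u) <> zero) by (rewrite HTS; exact Hu).
  pose proof (op_norm_pos T (S u) HT HTSu) as HTp.
  pose proof (norm_le_op_norm T (S u) HT) as H1. rewrite HTS in H1.
  pose proof (norm_le_op_norm S u HS) as H2.
  apply Rmult_le_reg_r with (1 := Hn). nra.
Qed.

Lemma not_cond_pseudospectrum_iff (eps : R) A S z :
  is_inverse (shift A z) S ->
  ~ cond_pseudospectrum eps A z <-> op_norm (shift A z) * op_norm S < / eps.
Proof.
  intros HS. split.
  - intros H. apply Rnot_le_lt. intros Hle. apply H. right.
    exists S. split; [exact HS|]. apply Rle_ge. exact Hle.
  - intros Hlt [Hsp|[S' [HS' Hge]]].
    + apply Hsp. exists S. exact HS.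
    + rewrite (op_norm_ext S' S) in Hge by (apply (is_inverse_unique _ _ _ HS' HS)).
      lra.
Qed.

(** With [c] the condition number, the set defining [kappa] is exactly the open interval from 0 to
    [/ c]: the constraint [eps < 1] comes for free because [1 <= c]. *)
Lemma kappa_eq A S z u :
  is_linear A -> is_inverse (shift A z) S -> u <> zero ->
  kappa z A = / (op_norm (shift A z) * op_norm S).
Proof.
  intros HA HS Hu.
  pose proof (condition_number_ge_1 _ _ _ (is_linear_shift A z HA) HS Hu) as Hc.
  set (c := op_norm (shift A z) * op_norm S) in *.
  assert (Hic : 0 < / c <= 1).
  { split; [apply Rinv_0_lt_compat; lra|].
    rewrite <- Rinv_1. apply Rinv_le_contravar; lra. }
  assert (HE : forall eps, 0 < eps < / c ->
                 0 < eps < 1 /\ ~ cond_pseudospectrum eps A z).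
  { intros eps He. split; [lra|].
    apply (not_cond_pseudospectrum_iff eps A S z HS). fold c.
    rewrite <- (Rinv_inv c). apply Rinv_lt_contravar; [|lra].
    apply Rmult_lt_0_compat; lra. }
  unfold kappa.
  rewrite (is_lub_Rbar_unique _ (Finite (/ c))); [reflexivity|].
  split.
  - intros eps [He Hp].
    apply (not_cond_pseudospectrum_iff eps A S z HS) in Hp. fold c in Hp.
    simpl. rewrite <- (Rinv_inv eps). apply Rinv_le_contravar; lra.
  - intros b Hb.
    (* A sample point of the interval: it excludes [b = m_infty] and makes a finite [b] positive. *)
    assert (H0 : Rbar_le (/ c / 2) b) by (apply Hb, HE; lra).
    destruct b as [b| |]; simpl in *; try tauto.
    apply Rnot_lt_le. intros Hlt.
    (* If [b < / c], their midpoint lies in the set yet exceeds [b]. *)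
    assert (H1 : Rbar_le ((b + / c) / 2) b) by (apply Hb, HE; lra).
    simpl in H1. lra.
Qed.

(** Each vector [v] satisfies [norm (T v) <= op_norm T * norm v] and
    [norm v <= op_norm S * norm (T v)]. Each estimate multiplies one of these at [dx] by the other
    at [x]. *)
Lemma relative_error_bounds T S x dx :
  is_linear T -> is_inverse T S -> T x <> zero ->
  / (op_norm T * op_norm S) * (norm (T dx) / norm (T x)) <= norm dx / norm x /\
  norm dx / norm x <= op_norm T * op_norm S * (norm (T dx) / norm (T x)).
Proof.
  intros HT HS HTx.
  pose proof (condition_number_ge_1 T S _ HT HS HTx) as Hc.
  destruct HS as [HS [HST _]].
  pose proof (norm_pos_of_neq_zero _ HTx) as Hy.
  assert (Hx : 0 < norm x).
  { apply norm_pos_of_neq_zero. intros ->. apply HTx. exact (linear_zero T HT). }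
  pose proof (op_norm_pos T x HT HTx) as HTp.
  assert (HSp : 0 < op_norm S) by nra.
  assert (inverse_bound : forall v, norm v <= op_norm S * norm (T v)).
  { intros v. rewrite <- (HST v) at 1. apply norm_le_op_norm, HS. }
  pose proof (inverse_bound x) as Hx1. pose proof (inverse_bound dx) as Hdx1.
  pose proof (norm_le_op_norm T x HT) as Hx2.
  pose proof (norm_le_op_norm T dx HT) as Hdx2.
  pose proof (norm_ge_0 dx). pose proof (norm_ge_0 (T dx)).
  set (t := op_norm T) in *. set (s := op_norm S) in *.
  set (a := norm x) in *. set (b := norm (T x)) in *.
  set (da := norm dx) in *. set (db := norm (T dx)) in *.
  split.
  - apply Rmult_le_reg_r with (t * s * b * a).
    { repeat apply Rmult_lt_0_compat; assumption. }
    replace (/ (t * s) * (db / b) * (t * s * b * a)) with (db * a) by (field; lra).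
    replace (da / a * (t * s * b * a)) with ((t * da) * (s * b)) by (field; lra).
    (* The factors are [db <= t * da] and [a <= s * b]. *)
    apply Rmult_le_compat; lra.
  - apply Rmult_le_reg_r with (b * a).
    { apply Rmult_lt_0_compat; assumption. }
    replace (da / a * (b * a)) with (da * b) by (field; lra).
    replace (t * s * (db / b) * (b * a)) with ((s * db) * (t * a)) by (field; lra).
    (* Here the roles swap: [da <= s * db] and [b <= t * a]. *)
    apply Rmult_le_compat; lra.
Qed.

End Operators.

Theorem theorem3p1 (X : CompleteNormedModule C_AbsRing)
  (A : X -> X) (HA : is_linear A)
  (z : C) (Hz : ~ spectrum A z)
  (x y : X) (Hy : y <> zero)
  (Hxy : minus (A x) (scal z x) = y)
  (dx dy : X)
  (Hpert : shift A z (plus x dx) = plus y dy) :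
  kappa z A * (norm dy / norm y) <= norm dx / norm x /\
  norm dx / norm x <= / kappa z A * (norm dy / norm y).
Proof.
  apply NNPP in Hz. destruct Hz as [S HS].
  pose proof (is_linear_shift A z HA) as HT.
  change (shift A z x = y) in Hxy.
  rewrite (linear_plus _ HT), Hxy in Hpert.
  (* Cancelling [y] leaves [shift A z dx = dy]. *)
  apply (@plus_reg_l X) in Hpert.
  rewrite (kappa_eq A S z y HA HS Hy), Rinv_inv.
  rewrite <- Hpert, <- Hxy.
  apply relative_error_bounds; [exact HT|exact HS|].
  rewrite Hxy. exact Hy.
Qed.
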